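(* For every integer $n \geq 2$, the binary complexity $\| n \|_{2}$ satisfies $$\| n \|_{2} \leq \lfloor \log_{2}(n) \rfloor + \nu_{2}(n) - 1,$$ where $\nu_{2}(n)$ denotes the number of ones in the base-$2$ digit expansion of $n$.
   Context: For a fixed natural number $m$, the $m$-ary complexity $\| n \|_{m}$ of a natural number $n \geq 1$ is the smallest number of possibly repeated selections from $\{1, 2, \ldots, m\}$ (counted with repetition) that can be used to express $n$ using any combination of addition, multiplication and bracket symbols, with the brackets forming legal nestings. Thus an admissible expression is either a single constant from $\{1, 2, \ldots, m\}$, or of the form $(E + F)$ or $(E \times F)$ with $E$ and $F$ admissible expressions; $\| n \|_{m}$ is the minimum, over all admissible expressions whose value is $n$, of the total number of occurrences of constants in the expression. The binary complexity $\| n \|_{2}$ is the case $m = 2$, in which the allowed constants are $1$ and $2$. For example, $\| 1 \|_{2} = \| 2 \|_{2} = 1$ and $\| 3 \|_{2} = 2$. Here $\log_{2}$ denotes the base-$2$ logarithm and $\lfloor \cdot \rfloor$ the floor function. Note that $\nu_{2}(n)$ is the binary digit sum of $n$ (not the $2$-adic valuation). *)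

(* Defs.v *)
From HB Require Import structures.
From mathcomp Require Import all_boot all_order all_algebra.
From mathcomp Require Import boolp reals exp.

Set Implicit Arguments.
Unset Strict Implicit.
Unset Printing Implicit Defensive.

Local Open Scope nat_scope.

Inductive aexpr : Type :=
  | Cst of nat
  | Add of aexpr & aexpr
  | Mul of aexpr & aexpr.

Fixpoint admissible (m : nat) (E : aexpr) : bool :=
  match E with
  | Cst c => 1 <= c <= m
  | Add F G => admissible m F && admissible m G
  | Mul F G => admissible m F && admissible m G
  end.

Fixpoint value (E : aexpr) : nat :=
  match E with
  | Cst c => c
  | Add F G => value F + value G
  | Mul F G => value F * value G
  end.

Fixpoint nconst (E : aexpr) : nat :=
  match E with
  | Cst _ => 1
  | Add F G => nconst F + nconst G
  | Mul F G => nconst F + nconst G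
  end.

Definition expressible (m n k : nat) : Prop :=
  exists E, [/\ admissible m E, value E = n & nconst E = k].

(* The least k such that expressible m n k. The value 0 is a junk value for the
   case where no admissible expression has value n, which happens only for
   m = 0 or n = 0 (see complexityP). *)
Definition complexity (m n : nat) : nat :=
  match pselect (exists k, `[< expressible m n k >]) with
  | left ex_k => ex_minn ex_k
  | right _ => 0
  end.

Lemma complexityP (m n : nat) : 0 < m -> 0 < n ->
  expressible m n (complexity m n) /\
  (forall k, expressible m n k -> complexity m n <= k).
Proof.
move=> m_gt0 n_gt0; rewrite /complexity.
case: pselect => [ex_k|[]].
  case: ex_minnP => k /asboolP kP k_min; split=> // j jP.
  by apply: k_min; apply/asboolP.
suff [k kP] : exists k, expressible m n k by exists k; apply/asboolP.
elim: n n_gt0 => // -[_ _|n /(_ isT) [k [E [aE vE _]]] _].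
  by exists 1, (Cst 1); split=> //=; rewrite m_gt0.
exists (nconst (Add E (Cst 1))), (Add E (Cst 1)).
by split=> //=; rewrite ?aE ?m_gt0 // vE addn1.
Qed.

Definition digit (b n i : nat) : nat := (n %/ b ^ i) %% b.

(* Only the positions i < n are counted; every digit at a position i >= n is 0,
   since n < 2 ^ n. *)
Definition nu2 (n : nat) : nat := #|[set i : 'I_n | digit 2 n i == 1]|.

Lemma digit_expansion (n : nat) : n = \sum_(i < n) digit 2 n i * 2 ^ i.
Proof.
have H k : n = n %/ 2 ^ k * 2 ^ k + \sum_(i < k) digit 2 n i * 2 ^ i.
  elim: k => [|k IHk]; first by rewrite big_ord0 expn0 muln1 divn1 addn0.
  rewrite big_ord_recr /= addnCA addnC.
  have -> : n %/ 2 ^ k.+1 * 2 ^ k.+1 + digit 2 n k * 2 ^ k = n %/ 2 ^ k * 2 ^ k.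
    by rewrite /digit expnSr divnMA (mulnC (2 ^ k) 2) mulnA -mulnDl -divn_eq.
  exact: IHk.
have lt_n : n < 2 ^ n by exact: ltn_expl.
by rewrite [LHS](H n) (divn_small lt_n) mul0n add0n.
Qed.

Local Open Scope ring_scope.

Definition log2 (R : realType) (x : R) : R := ln x / ln 2.

(* Main.v *)
Require Import Defs.
From HB Require Import structures.
From mathcomp Require Import all_boot all_order all_algebra.
From mathcomp Require Import reals.
From mathcomp Require Import exp.
Import Order.TTheory GRing.Theory Num.Theory.
Local Open Scope ring_scope.

(** Horner's scheme writes [n = 2 * (n./2) + odd n]: each doubling costs one
    constant 2, each nonzero digit one more constant 1.  Starting the recursion
    at 2 and 3 rather than at 1 saves the constant of the leading digit. *)

Lemma digit2_double (n i : nat) : digit 2 n i.+1 = digit 2 n./2 i.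
Proof. by rewrite /digit expnS divnMA divn2. Qed.

Lemma digit_eq0 (n i : nat) : (n <= i)%N -> digit 2 n i = 0%N.
Proof.
move=> le_ni; rewrite /digit divn_small //.
by apply: leq_ltn_trans le_ni _; exact: ltn_expl.
Qed.

(** Digits of [n] at positions [n] and above vanish. A free bound [k] lets the digit sums of [n] and
    [n./2] be compared over matching ranges. *)
Lemma nu2_sum (n k : nat) : (n <= k)%N -> nu2 n = (\sum_(i < k) digit 2 n i)%N.
Proof.
move=> le_nk; have -> : nu2 n = (\sum_(i < n) digit 2 n i)%N.
  rewrite /nu2 -sum1_card big_mkcond; apply: eq_bigr => i _.
  by rewrite inE /digit modn2; case: odd.
rewrite -(subnKC le_nk) big_split_ord /= [X in (_ + X)%N]big1 ?addn0 // => i _.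
by rewrite digit_eq0 ?leq_addr.
Qed.

Lemma nu2_half (n : nat) : nu2 n = (odd n + nu2 n./2)%N.
Proof.
(* With [n.+1] positions, splitting off digit 0 leaves [n] positions, enough for [n./2] as well. *)
rewrite (@nu2_sum n n.+1) // big_ord_recl /= /digit expn0 divn1 modn2.
rewrite (@nu2_sum n./2 n); last by rewrite -divn2 leq_div.
by congr addn; apply: eq_bigr => i _; exact: digit2_double.
Qed.

Lemma expressible_half (n k : nat) :
  expressible 2 n./2 k -> expressible 2 n (k + 1 + odd n).
Proof.
case=> E [aE vE nE]; have n_eq : n = (n./2 * 2 + odd n)%N.
  by rewrite muln2 addnC odd_double_half.
case: (odd n) n_eq => n_eq.
  by exists (Add (Mul E (Cst 2)) (Cst 1)); split; rewrite /= ?aE ?vE ?nE.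
exists (Mul E (Cst 2)); split; rewrite /= ?aE ?vE ?nE ?addn0 //.
by rewrite [RHS]n_eq addn0.
Qed.

Lemma expressible_trunc_log_nu2 (n : nat) : (2 <= n)%N ->
  expressible 2 n (trunc_log 2 n + nu2 n - 1).
Proof.
have [m] := ubnP n; elim: m n => // m IHm n le_nm n_ge2.
have nu2_1 : nu2 1 = 1%N by rewrite (@nu2_sum 1 1) // big_ord1.
(* Halving must not reach 1, where the formula gives 0 constants; hence 2 and 3 are base cases,
   written [2] and [1 + 2]. *)
have [n_ge4|n_lt4] := leqP 4 n; last first.
  have [->|->] : n = 2%N \/ n = 3%N
    by case: n n_ge2 n_lt4 {le_nm} => [|[|[|[|]]]] //; [left|right].
  - by rewrite trunc_log2S //= trunc_log1 nu2_half nu2_1; exists (Cst 2).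
  rewrite trunc_log2S //= trunc_log1 nu2_half nu2_1.
  by exists (Add (Cst 1) (Cst 2)).
have half_ge2 : (2 <= n./2)%N by exact: (half_leq n_ge4).
have half_lt : (n./2 < m)%N.
  by rewrite -ltnS; apply: leq_trans le_nm; rewrite !ltnS -divn2 ltn_Pdiv // ltnW.
have log_gt0 : (0 < trunc_log 2 n./2)%N by rewrite trunc_log_gt0.
suff -> : (trunc_log 2 n + nu2 n - 1 =
           trunc_log 2 n./2 + nu2 n./2 - 1 + 1 + odd n)%N.
  exact/expressible_half/IHm.
(* Doubling raises the logarithm by one and the last digit adds [odd n]; [log_gt0] keeps the
   truncated subtraction exact. *)
rewrite trunc_log2S // (nu2_half n) addSn subn1 /= subnK ?addn_gt0 ?log_gt0 //.
by rewrite -addnA [(_ + nu2 _)%N]addnC.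
Qed.

(** Take logarithms in [2 ^ trunc_log 2 n <= n]; an integer below a real is below its floor. *)
Lemma trunc_log_le_floor_log2 (R : realType) (n : nat) : (0 < n)%N ->
  (trunc_log 2 n)%:Z <= Num.floor (log2 (n%:R : R)).
Proof.
move=> n_gt0; rewrite floor_ge_int /log2.
have ln2_gt0 : 0 < ln (2 : R) by rewrite ln_gt0 // ltr1n.
rewrite ler_pdivlMr // mulrzl -pmulrn -lnXn ?ltr0n //.
rewrite ler_ln ?posrE ?exprn_gt0 ?ltr0n //.
by rewrite -natrX ler_nat trunc_logP.
Qed.

Theorem theorem2 (R : realType) (n : nat) (hn : (2 <= n)%N) :
  (complexity 2 n)%:Z <= Num.floor (log2 (n%:R : R)) + (nu2 n)%:Z - 1.
Proof.
have n_gt0 : (0 < n)%N by exact: ltnW.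
have log_gt0 : (0 < trunc_log 2 n)%N by rewrite trunc_log_gt0.
have [_ /(_ _ (expressible_trunc_log_nu2 n hn)) le_c] := @complexityP 2 n isT n_gt0.
apply: (@le_trans _ _ (trunc_log 2 n + nu2 n - 1)%N%:Z); first by rewrite lez_nat.
(* Since the logarithm is positive, natural and integer subtraction of 1 agree. *)
rewrite -subzn ?addn_gt0 ?log_gt0 // PoszD !lerD2r.
exact: trunc_log_le_floor_log2.
Qed.
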